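(* Let $Z$ be a compact Hausdorff space and let $X\subseteq Z$ be a subspace. The following conditions are equivalent: (a) Player I has a winning strategy in the $k$-Porada game $kP(Z,X)$. (b) Player I has a winning strategy in the Porada game $P(K(Z),K(X))$. (c) Player I has a winning strategy in the $k$-Porada game $kP(K(Z),K(X))$. (d) $Z\setminus X$ is not Menger. (e) $K(Z)\setminus K(X)$ is not Menger.
   Context: For a topological space $Y$, $K(Y)$ denotes the space of all nonempty compact subsets of $Y$ with the Vietoris topology, whose basic open sets are $\langle U_0,\dots,U_n\rangle=\{K\in K(Y): K\subseteq\bigcup_{i\le n}U_i \text{ and } K\cap U_i\ne\emptyset \text{ for every } i\le n\}$, with each $U_i$ open in $Y$. For $X\subseteq Z$, $K(X)$ is regarded as a subspace of $K(Z)$. A space $Y$ is Menger if for every sequence $(\mathcal{U}_n)_{n\in\omega}$ of open covers of $Y$ there are finite subfamilies $\mathcal{V}_n\subseteq\mathcal{U}_n$ such that $\bigcup_{n\in\omega}\mathcal{V}_n$ covers $Y$. Porada game $P(Z,X)$, for a topological space $Z$ and a subspace $X\subseteq Z$: players I and II alternate for $\omega$ many innings. In inning $n$, player I picks a pair $(x_n,U_n)$ with $x_n\in X$, $U_n$ open in $Z$, $x_n\in U_n$, and, if $n\ge1$, $U_n\subseteq V_{n-1}$ (so $x_n \in V_{n-1}$). Player II responds with an open set $V_n$ in $Z$ with $x_n\in V_n\subseteq U_n$. Player II wins if $\emptyset\ne\bigcap_{n\in\omega}U_n\subseteq X$; otherwise player I wins. $k$-Porada game $kP(Z,X)$: the same,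 except that in inning $n$ player I picks a pair $(K_n,U_n)$ with $K_n$ a nonempty compact subset of $X$, $U_n$ open in $Z$, $K_n\subseteq U_n$, and, if $n\ge1$, $U_n\subseteq V_{n-1}$. Player II responds with an open set $V_n$ in $Z$ with $K_n\subseteq V_n\subseteq U_n$. The winning condition is the same: player II wins if $\emptyset\ne\bigcap_{n\in\omega}U_n\subseteq X$; otherwise player I wins. A strategy of player I is a function giving a legal first move of player I and, for each finite sequence $(V_0,\dots,V_{n-1})$ of legal moves of player II made against the strategy, a legal next move of player I. (In particular, if player I has no legal first move, she has no strategy.) It is winning if player I wins every run in which she follows it. The games $P(K(Z),K(X))$ and $kP(K(Z),K(X))$ are these games played with $K(Z)$ and $K(X)$ in the roles of $Z$ and $X$. *)

(* Defs.v *)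
From HB Require Import structures.
From mathcomp Require Import all_boot all_classical topology.

Set Implicit Arguments.
Unset Strict Implicit.
Unset Printing Implicit Defensive.

Local Open Scope classical_set_scope.

Record hyperspace (Y : topologicalType) := Hyperspace {
  hyperspace_set :> set Y;
  hyperspace_compact : compact hyperspace_set;
  hyperspace_nonempty : hyperspace_set !=set0
}.

HB.instance Definition _ (Y : topologicalType) := gen_eqMixin (hyperspace Y).
HB.instance Definition _ (Y : topologicalType) :=
  gen_choiceMixin (hyperspace Y).

Section Vietoris.
Context {Y : topologicalType}.

(* The basic open set <U_0, ..., U_n> is encoded by the pair u = (n, U); the
   values of the sequence U beyond n are irrelevant. *)
Definition vietoris_index : set (nat * (nat -> set Y)) :=
  [set u | forall i, i <= u.1 -> open (u.2 i)].

Definition vietoris_basic (u : nat * (nat -> set Y)) : set (hyperspace Y) :=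
  [set K : hyperspace Y | K `<=` \bigcup_(i in [set i | i <= u.1]) u.2 i /\
    forall i, i <= u.1 -> K `&` u.2 i !=set0].

Lemma vietoris_basic_cover :
  \bigcup_(u in vietoris_index) vietoris_basic u = setT.
Proof.
apply/seteqP; split=> // K _; exists (0, fun=> setT).
  by move=> i _ /=; exact: openT.
split=> [y _|i _]; first by exists 0.
by rewrite setIT; exact: hyperspace_nonempty.
Qed.

Lemma vietoris_basic_join u v (K : hyperspace Y) :
  vietoris_index u -> vietoris_index v ->
  vietoris_basic u K -> vietoris_basic v K ->
  exists w, [/\ vietoris_index w, vietoris_basic w K &
    vietoris_basic w `<=` vietoris_basic u `&` vietoris_basic v].
Proof.
case: u v => [n U] [m V] oU oV [/= KU KUi] [/= KV KVj].
set A := \bigcup_(i in [set i | i <= n]) U i in KU.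
set B := \bigcup_(i in [set i | i <= m]) V i in KV.
have oA : open A by apply: bigcup_open.
have oB : open B by apply: bigcup_open.
pose W k := if k <= n then U k `&` B else V (k - n.+1) `&` A.
have Wl i : i <= n -> W i = U i `&` B by move=> h; rewrite /W h.
have Wr j : W (n.+1 + j) = V j `&` A.
  by rewrite /W leqNgt leq_addr /= addKn.
have WP k : k <= n.+1 + m -> k <= n \/ exists2 j, j <= m & k = n.+1 + j.
  move=> km; have [|nk] := leqP k n; first by left.
  by right; exists (k - n.+1); rewrite ?leq_subLR // subnKC.
exists (n.+1 + m, W); split.
- move=> k /WP[kn|[j jm ->]] /=.
    by rewrite Wl //; apply: openI => //; exact: (oU k).
  by rewrite Wr; apply: openI => //; exact: (oV j).
- split=> /= [y Ky|k /WP[kn|[j jm ->]]].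
  + have [i /= ni Uiy] := KU _ Ky; exists i => /=.
      by rewrite (leq_trans ni) // addSn leqW // leq_addr.
    by rewrite Wl //; split => //; exact: KV.
  + have [y [Ky Uy]] := KUi _ kn; exists y; split => //.
    by rewrite Wl //; split => //; exact: KV.
  + have [y [Ky Vy]] := KVj _ jm; exists y; split => //.
    by rewrite Wr; split => //; exact: KU.
- move=> L [/= LW LWk].
  have LAB y : (L : set Y) y -> A y /\ B y.
    move=> /LW[k /= /WP[kn|[j jm ->]]].
      by rewrite Wl // => -[Uy By]; split => //; exists k.
    by rewrite Wr => -[Vy Ay]; split => //; exists j.
  split; (split=> /= [y /LAB[]//|]); [move=> i im|move=> j jm].
  + have [|y [Ly]] := LWk i; last by rewrite Wl // => -[Uy _]; exists y.
    by rewrite (leq_trans im) // addSn leqW // leq_addr.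
  + have [|y [Ly]] := LWk (n.+1 + j); first by rewrite leq_add2l.
    by rewrite Wr => -[Vy _]; exists y.
Qed.

HB.instance Definition _ := isBaseTopological.Build (hyperspace Y)
  vietoris_basic_cover vietoris_basic_join.

End Vietoris.

(* K(X) as a subset of K(Z): a subset of X is compact in X iff it is compact
   in Z. *)
Definition hyperspace_of (Z : topologicalType) (X : set Z) :
  set (hyperspace Z) := [set K : hyperspace Z | K `<=` X].

Definition open_cover (Y : topologicalType) (U : set (set Y)) :=
  U `<=` open /\ cover U id = [set: Y].

Definition menger (Y : topologicalType) :=
  forall U : nat -> set (set Y), (forall n, open_cover (U n)) ->
  exists V : nat -> set (set Y),
    (forall n, V n `<=` U n /\ finite_set (V n)) /\
    cover (\bigcup_n V n) id = [set: Y].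

(* The games P(Z, X) and kP(Z, X) differ only in what player I picks inside the
   open sets: M is the type of these objects, legal says which of them player I
   may pick, and isin m U says that m lies inside U. *)
Section Game.
Context {Z : topologicalType} {M : Type}.
Variables (legal : set M) (isin : M -> set Z -> Prop) (X : set Z).

Implicit Types (mv : M * set Z) (Vs : seq (set Z)).

(* Vs = [:: V_0; ...; V_(n-1)] lists the previous moves of player II; at the
   first inning last setT Vs is the whole space, which is no constraint. *)
Definition legal_moveI Vs mv :=
  [/\ legal mv.1, open mv.2, isin mv.1 mv.2 & mv.2 `<=` last setT Vs].

Definition legal_moveII mv (V : set Z) :=
  [/\ open V, isin mv.1 V & V `<=` mv.2].

Definition winsII (U : nat -> set Z) :=
  \bigcap_n U n !=set0 /\ \bigcap_n U n `<=` X.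

(* Only the values of s on the sequences that are legal against s matter. *)
Implicit Type s : seq (set Z) -> M * set Z.

Definition legal_against s Vs := forall n, n < size Vs ->
  legal_moveII (s (take n Vs)) (nth set0 Vs n).

Definition strategyI s :=
  forall Vs, legal_against s Vs -> legal_moveI Vs (s Vs).

Definition winning_strategyI s := strategyI s /\
  forall V : nat -> set Z,
    (forall n, legal_moveII (s (mkseq V n)) (V n)) ->
    ~ winsII (fun n => (s (mkseq V n)).2).

Definition I_has_winning_strategy := exists s, winning_strategyI s.

End Game.

Definition I_wins_porada (Z : topologicalType) (X : set Z) :=
  I_has_winning_strategy X (fun (x : Z) (U : set Z) => U x) X.

Definition I_wins_kporada (Z : topologicalType) (X : set Z) :=
  I_has_winning_strategy (hyperspace_of X)
    (fun (K : hyperspace Z) (U : set Z) => K `<=` U) X.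

(* Main.v *)
Require Import Defs.
From mathcomp Require Import all_boot all_classical topology.

(* Hurewicz's argument: if player I has a strategy in kP(Z, X) and Y = Z \ X is
   Menger, then Y is Lindelof, so against each move of I player II needs only
   consider a decreasing sequence of answers V_m with Y contained in the union
   of the Z \ closure V_m. This gives a tree of positions indexed by finite
   sequences of naturals, and the Menger property, applied to covers that bound
   all positions of a given length at once, selects a branch along which the
   sets Z \ closure V_n cover Y; by compactness II wins along it.

   Conversely, let U_n be covers witnessing that Y is not Menger. Player I
   keeps compact sets K_n inside closed sets C_n, where K_n adds to K_(n-1) the
   points of C_n missed by U_n; whatever II answers, C_n minus the next closed
   set is covered by finitely many members of U_n. These finite families miss
   some y in Y, so the intersection of the C_n is a compact set that is not
   contained in X and lies in all the open sets played. This works in kP(Z, X)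
   and in P(K(Z), K(X)) alike.

   K(Z) is compact Hausdorff, so the first part also applies to kP(K(Z), K(X)).
   The Menger property passes between Y and K(Z) \ K(X) because a compact set
   lies outside K(X) iff it meets Y, and because the compact sets through a
   point form a compact family. *)

Set Implicit Arguments.
Unset Strict Implicit.
Unset Printing Implicit Defensive.

Local Open Scope classical_set_scope.

(** * Decreasing sequences, compactness and shrinking of neighbourhoods *)

Lemma subset_decreasing (T : Type) (C : nat -> set T) :
  (forall n, C n.+1 `<=` C n) -> forall m n, m <= n -> C n `<=` C m.
Proof.
move=> decC; apply: (homo_leq (r := fun A B : set T => B `<=` A)) => //.
- by move=> A x.
- by move=> B A D BA DB; exact: subset_trans DB BA.
Qed.

Section Compactness.
Variable Z : topologicalType.
Implicit Types (A B C : set Z) (U : set (set Z)).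

(** The sets [A] minus a finite union of members of [U] generate a filter, proper if no finite
    subfamily covers; a cluster point in [A] contradicts the member of [U] containing it. *)
Lemma compact_finite_subcover A U : compact A -> U `<=` open ->
  A `<=` \bigcup_(O in U) O ->
  exists V, [/\ V `<=` U, finite_set V & A `<=` \bigcup_(O in V) O].
Proof.
move=> cA oU AU; apply: contrapT => nV.
pose fin := [set V | V `<=` U /\ finite_set V].
pose F := filter_from fin (fun V => A `\` \bigcup_(O in V) O).
have FF : ProperFilter F.
  apply: filter_from_proper; last first.
    move=> V [VU fV]; apply: contrapT => AV; apply: nV; exists V; split => // x Ax.
    by apply: contrapT => nx; apply: AV; exists x.
  apply: filter_from_filter; first by exists set0; split => //; exact: finite_set0.
  move=> V W [VU fV] [WU fW]; exists (V `|` W).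
    by split; [rewrite subUset|rewrite finite_setU].
  by move=> x [Ax nx]; split; split => //; apply: contra_not nx => -[O h Ox];
    exists O => //; [left|right].
have FA : F A by exists set0; [split => //; exact: finite_set0|move=> x []].
have [x [Ax Fx]] := cA F FF FA.
have [O UO Ox] := AU x Ax.
have FO : F (A `\` O).
  exists [set O]; first by split => //; rewrite sub1set; exact/mem_set.
  by move=> y [Ay ny]; split => //; apply: contra_not ny; exists O.
have [|y [[_ nOy]]//] := Fx _ O FO.
by apply: open_nbhs_nbhs; split => //; exact: oU.
Qed.

Lemma compact_bigcap_closed (C : nat -> set Z) : compact [set: Z] ->
  (forall n, closed (C n)) -> (forall n, C n !=set0) ->
  (forall m n, m <= n -> C n `<=` C m) -> \bigcap_n C n !=set0.
Proof.
move=> cZ cC C0 decC; pose F := filter_from setT C.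
have FF : ProperFilter F.
  apply: filter_from_proper => //; apply: filter_from_filter; first by exists 0.
  move=> m n _ _; exists (maxn m n) => // x Cx.
  by split; apply: decC Cx; [exact: leq_maxl|exact: leq_maxr].
have [|x [_ Fx]] := cZ F FF; first exact: filterT.
by exists x => n _; apply: cC => B Bx; apply: Fx => //; exists n.
Qed.

Lemma closed_compact A : compact [set: Z] -> closed A -> compact A.
Proof. by move=> cZ cA; exact: (subclosed_compact cA cZ). Qed.

Lemma open_setC1 (x : Z) : hausdorff_space Z -> open (~` [set x]).
Proof.
by move=> hZ; apply/closed_openC/accessible_closed_set1/hausdorff_accessible.
Qed.

Lemma compact_shrink A B : compact [set: Z] -> hausdorff_space Z ->
  closed A -> open B -> A `<=` B ->
  exists V, [/\ open V, A `<=` V & closure V `<=` B].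
Proof.
move=> cZ hZ cA oB AB.
have [|W /set_nbhsP[V [oV AV VW]] WB] := compact_normal hZ cZ cA (t := B).
  by apply/set_nbhsP; exists B; split.
by exists V; split => //; exact: subset_trans (closureS VW) WB.
Qed.

End Compactness.

(** * The Menger property of a subset, and its use for trees and neighbourhoods *)

Definition menger_in (Z : topologicalType) (Y : set Z) :=
  forall U : nat -> set (set Z), (forall n, U n `<=` open) ->
  (forall n, Y `<=` \bigcup_(O in U n) O) ->
  exists V : nat -> set (set Z), (forall n, V n `<=` U n /\ finite_set (V n)) /\
    Y `<=` \bigcup_n \bigcup_(O in V n) O.

(** Open sets of the subtype are traces of open sets of [Z]. Working with the latter makes closures
    and compactness in [Z] available. *)
Lemma menger_set_typeP (Z : topologicalType) (Y : set Z) :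
  menger (set_type Y) <-> menger_in Y.
Proof.
split=> [mY U oU YU|mY U cU].
- pose pre n := [set (@set_val _ Y) @^-1` O | O in U n].
  have [n|W [WU cW]] := mY pre.
    split=> [_ [O UO <-]|]; first by exists O => //; exact: oU UO.
    apply/seteqP; split => // y _; have [O UO Oy] := YU n _ (set_valP y).
    by exists (set_val @^-1` O) => //; exists O.
  have [g gP] : exists g : nat -> set (set_type Y) -> set Z,
      forall n P, pre n P -> U n (g n P) /\ set_val @^-1` (g n P) = P.
    have /choice[g gP] : forall nP : nat * set (set_type Y), exists O,
        pre nP.1 nP.2 -> U nP.1 O /\ set_val @^-1` O = nP.2.
      move=> [n P]; have [[O UO <-]|nP] := pselect (pre n P); first by exists O.
      by exists setT => /nP.
    by exists (fun n P => g (n, P)) => n P; exact: (gP (n, P)).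
  exists (fun n => g n @` W n); split => [n|y Yy].
    have [WnU fW] := WU n; split; last exact: finite_image.
    by move=> _ [P WP <-]; have [] := gP n P (WnU _ WP).
  have : (cover (\bigcup_n W n) id) (exist _ y (mem_set Yy)) by rewrite cW.
  case=> P [n _ WP] Py; exists n => //; exists (g n P); first by exists P.
  have [_ gPE] := gP n P ((WU n).1 _ WP).
  by move: Py; rewrite -{1}gPE.
- pose ext n := [set O | open O /\ U n ((@set_val _ Y) @^-1` O)].
  have [n O []//|n y Yy|W [WU YW]] := mY ext.
    have [oU UT] := cU n.
    have : (cover (U n) id) (exist _ y (mem_set Yy)) by rewrite UT.
    case=> P UP; have [O oO OP] := oU P UP; rewrite -OP => Oy.
    by exists O => //; split => //; rewrite OP.
  exists (fun n => preimage set_val @` W n); split => [n|].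
    have [WnU fW] := WU n; split; last exact: finite_image.
    by move=> _ [O /WnU[_ UO] <-].
  apply/seteqP; split => // y _; have [n _ [O WO Oy]] := YW _ (set_valP y).
  by exists (set_val @^-1` O) => //; exists n => //; exists O.
Qed.

Lemma filter_finite_bigcap (T : Type) (I : choiceType) (D : set I)
    (f : I -> set T) (F : set_system T) : Filter F -> finite_set D ->
  (forall i, D i -> F (f i)) -> F (\bigcap_(i in D) f i).
Proof.
by move=> FF /finite_fsetP[X ->] Ff; apply: filter_bigI => i; exact: Ff.
Qed.

(** The [n]-th cover consists of open sets that, for all large [k], lie in [G (rcons t k)] for every
    [t] of length [n] simultaneously. A finite subfamily then admits one common [k], which becomes
    [f n]. *)
Lemma menger_tree (Z : topologicalType) (Y : set Z) (G : seq nat -> set Z) :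
  menger_in Y -> (forall s, open (G s)) ->
  (forall s m, G s `<=` G (rcons s m)) ->
  (forall s m k, m <= k -> G (rcons s m) `<=` G (rcons s k)) ->
  (forall s, Y `<=` \bigcup_m G (rcons s m)) ->
  exists f : nat -> nat, Y `<=` \bigcup_n G (mkseq f n).
Proof.
move=> mY oG Gs Gm YG.
have Gcat s t : G s `<=` G (s ++ t).
  elim/last_ind: t => [|t m IH]; first by rewrite cats0.
  by rewrite -rcons_cat; exact: subset_trans IH (Gs _ _).
(* Only finitely many initial moves fail to put y in G at once, which makes
   this uniform in the position t by induction on its length. *)
have unif n s y : Y y -> filter_prod (nbhs y) \oo
    [set p | forall t, size t = n -> G (s ++ rcons t p.2) p.1].
  move=> Yy; elim: n s => [|n IH] s.
    have [m _ Gy] := YG s y Yy.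
    exists (G (rcons s m), [set k | m <= k]).
      by split; [exact: (open_nbhs_nbhs (conj (oG _) Gy))|exact: nbhs_infty_ge].
    by move=> [x k] [/= Gx mk] t /size0nil ->; rewrite cats1; apply: Gm mk _ Gx.
  have [m _ Gy] := YG s y Yy.
  have big : filter_prod (nbhs y) \oo [set p : Z * nat | G (rcons s m) p.1].
    exists (G (rcons s m), setT); last by move=> [x k] [].
    by split; [exact: (open_nbhs_nbhs (conj (oG _) Gy))|exact: filterT].
  have FP : Filter (filter_prod (nbhs y) \oo) by exact _.
  have fin := filter_forall FP (fun i : 'I_m => IH (rcons s i)).
  apply: filterS (filterI fin big) => -[x k] /= [Gfin Gx] [//|i t] /= [tn].
  rewrite -cat_rcons; have [im|mi] := ltnP i m.
    exact: (Gfin (Ordinal im)).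
  by apply: Gcat; apply: Gm mi _ Gx.
pose U n := [set O | open O /\ exists m, forall k, m <= k ->
  forall t, size t = n -> O `<=` G (rcons t k)].
have [n O []//|n y Yy|V [VU YV]] := mY U.
  have [[A B] [/= nA [m _ mB]] AB] := unif n [::] y Yy.
  move: nA; rewrite nbhsE => -[O [oO Oy] OA]; exists O => //; split => //.
  exists m => k mk t tn x Ox; apply: (AB (x, k)) => //.
  by split; [exact: OA|exact: mB].
have /choice[f fP] : forall n, exists m, forall O, V n O ->
    forall t, size t = n -> O `<=` G (rcons t m).
  move=> n; have [VnU fV] := VU n.
  suff : \forall k \near \oo, (\bigcap_(O in V n)
      [set k | forall t, size t = n -> O `<=` G (rcons t k)]) k.
    by move=> /filter_ex.
  apply: filter_finite_bigcap => // O /VnU[_ [m mP]].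
  by exists m => // k /= mk t tn; exact: mP.
(* Members of [V n] lie in [G] at positions of length [n.+1], hence the shift. *)
exists f => y /YV[n _ [O VO Oy]]; exists n.+1 => //; rewrite mkseqS.
by apply: (fP n O VO) => //; rewrite size_mkseq.
Qed.

(** The Menger property is applied to a constant sequence of covers, that is, as the Lindelof
    property. Finitely many members of [F] are kept away from [K] by a single open set [S n]. *)
Lemma menger_in_shrink (Z : topologicalType) (Y K U : set Z) :
  compact [set: Z] -> hausdorff_space Z -> menger_in Y ->
  closed K -> open U -> K `<=` U -> K `<=` ~` Y ->
  exists V : nat -> set Z,
    [/\ forall n, [/\ open (V n), K `<=` V n & closure (V n) `<=` U],
        forall m n, m <= n -> V n `<=` V m &
        Y `<=` \bigcup_n ~` closure (V n)].
Proof.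
move=> cZ hZ mY cK oU KU KY.
have [V0 [oV0 KV0 V0U]] := compact_shrink cZ hZ cK oU KU.
pose F := [set O | open O /\ set_nbhs K (~` O)].
have [_ O []//|_ y Yy|W [WF YW]] := mY (fun=> F).
  have [||V [oV KV Vy]] := compact_shrink (B := ~` [set y]) cZ hZ cK.
  - exact: open_setC1.
  - by move=> z Kz zy; apply: KY Kz _; rewrite zy.
  exists (~` closure V); last by move=> /Vy; apply.
  split; first exact/closed_openC/closed_closure.
  by rewrite setCK; apply/set_nbhsP; exists V; split => //; exact: subset_closure.
have /choice[S SP] : forall n, exists S,
    [/\ open S, K `<=` S & forall O, W n O -> closure S `<=` ~` O].
  move=> n; have [WnF fW] := WF n.
  have : set_nbhs K (\bigcap_(O in W n) ~` O).
    by apply: filter_finite_bigcap => // O /WnF[].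
  move=> /set_nbhsP[S [oS KS SW]]; exists S; split => // O WO.
  have [oO _] := WnF O WO.
  apply: subset_trans (open_closedC oO).
  by apply: closureS => z /SW; exact.
(* Starting from [V0] keeps all closures inside [U], and the intersections make the sequence
   decreasing. *)
pose V := fix V n := if n is m.+1 then V m `&` S m else V0.
have VS n : V n.+1 = V n `&` S n by [].
have decV : forall m n, m <= n -> V n `<=` V m.
  by apply: subset_decreasing => n; rewrite VS; exact: subIsetl.
exists V; split => // [n|y /YW[n _ [O WO Oy]]].
  have : open (V n) /\ K `<=` V n.
    elim: n => [//|n [oV KV]]; rewrite VS; have [oS KS _] := SP n.
    by split; [exact: openI|move=> x Kx; split; [exact: KV|exact: KS]].
  move=> [oV KV]; split => //; apply: subset_trans V0U.
  by apply: closureS; exact: (decV 0 n).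
exists n.+1 => //; rewrite VS => /closureI[_ Sy].
by have [_ _ /(_ O WO y Sy)] := SP n.
Qed.

(** * Legal runs, and points played as singletons *)

Section Legality.
Context {Z : topologicalType} {M : Type}.
Variables (isin : M -> set Z -> Prop) (s : seq (set Z) -> M * set Z).

Lemma legal_against_rcons Vs V : legal_against isin s (rcons Vs V) <->
  legal_against isin s Vs /\ legal_moveII isin (s Vs) V.
Proof.
have tk n : n <= size Vs -> take n (rcons Vs V) = take n Vs.
  by move=> nV; rewrite -cats1 takel_cat.
split=> [legV|[legV legmV] n].
  split=> [n nV|].
    have := legV n; rewrite size_rcons tk ?(ltnW nV)// nth_rcons nV.
    by apply; exact: leqW.
  have := legV (size Vs).
  by rewrite size_rcons tk// take_size nth_rcons ltnn eqxx; exact.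
rewrite size_rcons ltnS leq_eqVlt => /predU1P[->|nV].
  by rewrite tk// take_size nth_rcons ltnn eqxx.
by rewrite tk ?(ltnW nV)// nth_rcons nV; exact: legV.
Qed.

Lemma legal_against_mkseq (V : nat -> set Z) :
  (forall n, legal_moveII isin (s (mkseq V n)) (V n)) ->
  forall n, legal_against isin s (mkseq V n).
Proof.
by move=> legV; elim=> [//|n IH]; rewrite mkseqS; exact/legal_against_rcons.
Qed.

End Legality.

Definition hyperspace1 (Y : topologicalType) (y : Y) : hyperspace Y :=
  Hyperspace (compact_set1 (x := y)) (ex_intro _ y erefl).

(** A singleton lies in an open set exactly when its point does, so both games admit the same
    answers of player II. *)
Lemma I_wins_porada_kporada (Z : topologicalType) (X : set Z) :
  I_wins_porada X -> I_wins_kporada X.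
Proof.
move=> [s [sS sW]]; pose s' Vs := (hyperspace1 (s Vs).1, (s Vs).2).
have legII mv (V : set Z) : legal_moveII (fun K : hyperspace Z => subset K)
    (hyperspace1 mv.1, mv.2) V <-> legal_moveII (fun (x : Z) U => U x) mv V.
  by split=> -[oV /= xV VU]; split => //; [exact: xV|move=> _ ->].
exists s'; split=> [Vs legVs|V legV].
  have [|Xx oU Ux UV] := sS Vs; first by move=> n nV; apply/legII; exact: legVs.
  by split => //= _ ->.
by apply: sW => n; apply/legII; exact: legV.
Qed.

Lemma hyperspace_closed (Y : topologicalType) (K : hyperspace Y) :
  hausdorff_space Y -> closed K.
Proof. by move=> hY; apply: compact_closed => //; exact: hyperspace_compact. Qed.

(** * Strategies of player I against the Menger property, in both directions *)

Lemma kporada_not_menger (Z : topologicalType) (X : set Z) :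
  compact [set: Z] -> hausdorff_space Z -> I_wins_kporada X ->
  ~ menger_in (~` X).
Proof.
move=> cZ hZ [s [sS sW]] mY.
(* [opt mv] lists the answers to [mv] that player II considers; [setT] is the default for illegal
   moves. *)
have /choice[opt optP] : forall mv : hyperspace Z * set Z, exists V : nat -> set Z,
    mv.1 `<=` X -> open mv.2 -> mv.1 `<=` mv.2 ->
    [/\ forall n, [/\ open (V n), mv.1 `<=` V n & closure (V n) `<=` mv.2],
        forall m n, m <= n -> V n `<=` V m &
        ~` X `<=` \bigcup_n ~` closure (V n)].
  move=> [K U]; have [KX|nKX] := pselect (K `<=` X); last by exists (fun=> setT).
  have [oU|noU] := pselect (open U); last by exists (fun=> setT).
  have [KU|nKU] := pselect (K `<=` U); last by exists (fun=> setT).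
  have [||V VP] := menger_in_shrink cZ hZ mY _ oU KU.
  - exact: hyperspace_closed.
  - by rewrite setCK.
  - by exists V.
(* [pos t] is the position reached when player II picks option number [t_i] in inning [i]. *)
pose pos := foldl (fun Vs (m : nat) => rcons Vs (opt (s Vs) m)) [::].
have posS t m : pos (rcons t m) = rcons (pos t) (opt (s (pos t)) m).
  by rewrite /pos foldl_rcons.
have legal_opt Vs :
    legal_against (fun K : hyperspace Z => subset K) s Vs ->
    [/\ forall n, [/\ open (opt (s Vs) n), (s Vs).1 `<=` opt (s Vs) n &
          closure (opt (s Vs) n) `<=` (s Vs).2],
        forall m n, m <= n -> opt (s Vs) n `<=` opt (s Vs) m &
        ~` X `<=` \bigcup_n ~` closure (opt (s Vs) n)].
  by move=> /sS[KX oU KU _]; exact: optP.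
have legal_reply Vs m : legal_against (fun K : hyperspace Z => subset K) s Vs ->
    legal_moveII (fun K : hyperspace Z => subset K) (s Vs) (opt (s Vs) m).
  move=> /legal_opt[optVs _ _]; have [oV KV VU] := optVs m; split => //.
  exact: subset_trans (@subset_closure _ _) VU.
have pos_legal t : legal_against (fun K : hyperspace Z => subset K) s (pos t).
  elim/last_ind: t => [//|t m IH]; rewrite posS; apply/legal_against_rcons.
  by split => //; exact: legal_reply.
(* [G t] is what the last answer has discarded; it is empty at the start, where the last answer is
   read as [setT]. *)
pose G t := ~` closure (last setT (pos t)).
have Grcons t m : G (rcons t m) = ~` closure (opt (s (pos t)) m).
  by rewrite /G posS last_rcons.
have closure_opt t m : closure (opt (s (pos t)) m) `<=` last setT (pos t).
  have [optt _ _] := legal_opt _ (pos_legal t); have [_ _ VU] := optt m.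
  by have [_ _ _] := sS _ (pos_legal t); exact: subset_trans.
have [t|t m|t m k mk|t|f YG] := menger_tree (G := G) mY.
- exact/closed_openC/closed_closure.
- rewrite Grcons; apply: subsetC; apply: subset_trans (closure_opt t m) _.
  exact: subset_closure.
- rewrite !Grcons; apply/subsetC/closureS.
  by have [_ dec _] := legal_opt _ (pos_legal t); exact: dec.
- have [_ _ cov] := legal_opt _ (pos_legal t).
  by move=> y /cov[m _ Gy]; exists m => //; rewrite Grcons.
pose V n := opt (s (pos (mkseq f n))) (f n).
have Vpos n : mkseq V n = pos (mkseq f n).
  by elim: n => // n IH; rewrite !mkseqS posS IH.
have VU n : closure (V n) `<=` (s (mkseq V n)).2.
  by rewrite Vpos; have [/(_ (f n))[]] := legal_opt _ (pos_legal (mkseq f n)).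
have decV n : closure (V n.+1) `<=` V n.
  have := closure_opt (mkseq f n.+1) (f n.+1).
  by rewrite -/(V n.+1) -Vpos mkseqS last_rcons.
apply: (sW V) => [n|]; first by rewrite Vpos; exact/legal_reply/pos_legal.
split.
  have [n|n|m n|x Vx] := compact_bigcap_closed (C := fun n => closure (V n)) cZ.
  - exact: closed_closure.
  - have [optn _ _] := legal_opt _ (pos_legal (mkseq f n)).
    have [_ KV _] := optn (f n).
    have [x Kx] := hyperspace_nonempty (s (pos (mkseq f n))).1.
    by exists x; apply: subset_closure; exact: KV.
  - apply: (subset_decreasing (C := closure \o V)) => {}n.
    exact: subset_trans (decV n) (@subset_closure _ _).
  - by exists x => n _; apply: VU; exact: Vx.
(* A point outside [X] is discarded by the answer preceding some inning, and the open set of player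
   I in that inning is contained in this answer. *)
move=> z Uz; apply: contrapT => /YG[n _]; apply; apply: subset_closure.
have [_ _ _] := sS _ (pos_legal (mkseq f n)); apply.
by rewrite -Vpos; exact: Uz.
Qed.

(* In kP(Z, X) the relation isin K U is K `<=` U, in P(K(Z), K(X)) it is U K; the
   picks of player I are compact subsets of X in both games. *)
Lemma not_menger_I_wins (Z Z0 : topologicalType) (X : set Z)
    (isin : hyperspace Z -> set Z0 -> Prop) (X0 : set Z0) :
  compact [set: Z] ->
  (forall K, isin K setT) ->
  (forall (K : hyperspace Z) U, open U -> isin K U -> exists V, [/\ open V,
     K `<=` V & forall L : hyperspace Z, K `<=` L -> L `<=` closure V ->
       isin L U]) ->
  (forall (L : hyperspace Z) (U : nat -> set Z0), (forall n, isin L (U n)) ->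
     \bigcap_n U n `<=` X0 -> L `<=` X) ->
  ~ menger_in (~` X) -> I_has_winning_strategy (hyperspace_of X) isin X0.
Proof.
move=> cZ isinT sandwich winP.
move=> /existsNP[U] /not_implyP[oU] /not_implyP[YU] /forallNP noV.
pose O n := \bigcup_(A in U n) A.
have oO n : open (O n) by apply: bigcup_open => A; exact: oU.
have covered A n : closed A -> A `<=` O n ->
    exists V, [/\ V `<=` U n, finite_set V & A `<=` \bigcup_(B in V) B].
  by move=> cA AO; apply: compact_finite_subcover => //; exact: closed_compact.
(* If [O 0] were all of [Z], a finite part of [U 0] would cover [Z], contradicting [noV]. *)
have [K0 K0E] : exists K0 : hyperspace Z, K0 = ~` O 0 :> set Z.
  have cK0 : compact (~` O 0) by exact/closed_compact/open_closedC.
  suff K00 : ~` O 0 !=set0 by exists (Hyperspace cK0 K00).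
  apply: contrapT => OT.
  have [z _|W [WU fW ZW]] := covered setT 0 closedT.
    by apply: contrapT => nOz; apply: OT; exists z.
  apply: (noV (fun n => if n is 0 then W else set0)); split=> [[//|n]|y _].
    by split; [exact: sub0set|exact: finite_set0].
  by exists 0 => //; exact: ZW.
(* As long as the later compact sets contain [K] and stay in the closure of [r (K, W)], they remain
   inside [W] in the sense of the game. *)
have /choice[r rP] : forall KU : hyperspace Z * set Z0, exists V,
    open KU.2 -> isin KU.1 KU.2 -> [/\ open V, KU.1 `<=` V &
      forall L : hyperspace Z, KU.1 `<=` L -> L `<=` closure V -> isin L KU.2].
  move=> [K W]; have [oW|noW] := pselect (open W); last by exists setT.
  have [KW|nKW] := pselect (isin K W); last by exists setT.
  by have [V VP] := sandwich K W oW KW; exists V.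
have /choice[e eP] : forall nKC : nat * hyperspace Z * set Z,
    exists K : hyperspace Z, closed nKC.2 ->
    K = nKC.1.2 `|` (nKC.2 `\` O nKC.1.1) :> set Z.
  move=> [[n K] C]; have [cC|nC] := pselect (closed C); last by exists K.
  have cK : compact (K `|` (C `\` O n)).
    apply: compactU; first exact: hyperspace_compact.
    by apply: closed_compact => //; apply: closedI => //; exact: open_closedC.
  have K_neq0 : K `|` (C `\` O n) !=set0.
    by have [x Kx] := hyperspace_nonempty K; exists x; left.
  by exists (Hyperspace cK K_neq0).
(* A state consists of the inning, the compact pick and the closed set. The closed set is cut down
   first, so that the enlarged pick stays within it. *)
pose step (st : nat * hyperspace Z * set Z) W :=
  let C := st.2 `&` closure (r (st.1.2, W)) in
  (st.1.1.+1, e (st.1.1.+1, st.1.2, C), C).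
pose run := foldl step (0, K0, setT).
pose s Vs := ((run Vs).1.2, last setT Vs).
have runS Vs W : run (rcons Vs W) = step (run Vs) W by exact: foldl_rcons.
pose inv (st : nat * hyperspace Z * set Z) :=
  [/\ closed st.2, st.1.2 `<=` X, st.1.2 `<=` st.2 & st.2 `\` O st.1.1 `<=` st.1.2].
have run_inv Vs : legal_against isin s Vs ->
    [/\ inv (run Vs), isin (run Vs).1.2 (last setT Vs) & open (last setT Vs)].
  elim/last_ind: Vs => [_|Vs W IH].
    split => //=; last exact: openT.
    split => //=; rewrite K0E; last by move=> x [].
    by move=> x nOx; apply: contrapT => /(YU 0).
  move=> /legal_against_rcons[/IH[[cC KX KC CO] Klast olast] [oW KW WU]].
  rewrite runS last_rcons /step.
  have [oR KR RW] := rP ((run Vs).1.2, W) oW KW.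
  set C := _ `&` _.
  have cC' : closed C by apply: closedI => //; exact: closed_closure.
  have KC' : (run Vs).1.2 `<=` C.
    by move=> x Kx; split; [exact: KC|apply: subset_closure; exact: KR].
  have K'E := eP ((run Vs).1.1.+1, (run Vs).1.2, C) cC'.
  have K'C : e ((run Vs).1.1.+1, (run Vs).1.2, C) `<=` C.
    by rewrite K'E => x [/KC'|[]].
  split => //; last first.
    apply: RW; last by apply: subset_trans K'C _ => x [].
    by rewrite K'E => x Kx; left.
  split => //=; last by rewrite K'E => x Cx; right.
  rewrite K'E => x [/KX//|[_ nOx]].
  by apply: contrapT => /(YU (run Vs).1.1.+1).
exists s; split=> [Vs /run_inv[[cC KX KC CO] KW oW]|V legV]; first by split.
have legs := legal_against_mkseq legV.
pose K n := (run (mkseq V n)).1.2; pose C n := (run (mkseq V n)).2.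
pose R n := r (K n, V n).
have runn n : (run (mkseq V n)).1.1 = n.
  by elim: n => // n IH; rewrite mkseqS runS /= IH.
have invn n : [/\ closed (C n), K n `<=` C n & C n `\` O n `<=` K n].
  by have [[cC _ KC CO] _ _] := run_inv _ (legs n); rewrite runn in CO.
have Rn n : [/\ open (R n), K n `<=` R n & forall L : hyperspace Z, K n `<=` L ->
    L `<=` closure (R n) -> isin L (V n)].
  by have [oV KV _] := legV n; apply: (rP (K n, V n)).
have CS n : C n.+1 = C n `&` closure (R n) by rewrite /C mkseqS runS.
have incK n : K n `<=` K n.+1.
  rewrite /K mkseqS runS /= eP ?runn; first by move=> x; left.
  by have [cC _ _] := invn n.+1; rewrite CS in cC.
have le_incK : {homo K : m n / m <= n >-> m `<=` n}.
  apply: (homo_leq (r := fun A B : hyperspace Z => A `<=` B)) => //.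
    by move=> A x.
  by move=> B A D; exact: subset_trans.
have le_decC : forall m n, m <= n -> C n `<=` C m.
  by apply: subset_decreasing => n; rewrite CS; exact: subIsetl.
(* [K n] contains all points of [C n] outside [O n] and lies in [R n]; hence the closed set [C n]
   minus [R n] is contained in [O n], and compactness applies. *)
have /choice[F FP] : forall n, exists F, [/\ F `<=` U n, finite_set F &
    C n `\` R n `<=` \bigcup_(B in F) B].
  move=> n; have [cC _ CO] := invn n; have [oR KR _] := Rn n.
  apply: covered; first by apply: closedI => //; exact: open_closedC.
  move=> x [Cx nRx]; apply: contrapT => nOx; apply: nRx; apply: KR.
  exact: CO.
have [y [nXy nFy]] : exists y, ~ X y /\ forall n, ~ (\bigcup_(B in F n) B) y.
  apply: contrapT => noy; apply: (noV F); split=> [n|y nXy].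
    by have [] := FP n.
  apply: contrapT => nFy; apply: noy; exists y; split => // n Fy.
  by apply: nFy; exists n.
(* A point of [C n] not covered by [F n] lies in [R n], hence survives into [C n.+1]. *)
have Cy n : C n y.
  elim: n => [//|n Cny]; rewrite CS; split => //; apply: subset_closure.
  by apply: contrapT => nRy; apply: (nFy n); have [_ _] := FP n; apply.
have KC m n : K m `<=` C n.
  have [mn|/ltnW nm] := leqP m n.
    by have [_ KC _] := invn n; apply: subset_trans KC; exact: le_incK.
  by have [_ KC _] := invn m; apply: subset_trans KC _; exact: le_decC.
have cL : compact (\bigcap_n C n).
  by apply: closed_compact => //; apply: closed_bigI => n _; have [] := invn n.
have L_neq0 : \bigcap_n C n !=set0 by exists y => n _.
move=> [_ UX0]; apply: nXy.
(* The first open set played is [setT]; the one of inning [n.+1] is the answer [V n], which [R n]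
   controls. *)
apply: (winP (Hyperspace cL L_neq0) _ _ UX0) => [[|n]|n _].
- exact: isinT.
- rewrite mkseqS /s /= last_rcons; have [_ _] := Rn n; apply=> [x Kx m _|x Cx].
    exact: KC Kx.
  by have := Cx n.+1 I; rewrite CS => -[].
- exact: Cy.
Qed.

(** * The Vietoris topology: open families, compactness and separation *)

Section Hyperspace.
Context {Y : topologicalType}.
Implicit Types (K L : hyperspace Y) (W : set Y).

Lemma hyperspace_inj K L : K = L :> set Y -> K = L.
Proof.
case: K L => [K cK K0] [L cL L0] /= KL; case: _ / KL in cL L0 *.
by congr Hyperspace; exact: Prop_irrelevance.
Qed.

Lemma open_vietoris_basic u : vietoris_index u ->
  open (vietoris_basic u : set (hyperspace Y)).
Proof.
by move=> iu; exists [set u]; [move=> _ ->|rewrite bigcup_set1].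
Qed.

Lemma open_vietorisP (V : set (hyperspace Y)) K : open V -> V K ->
  exists u, [/\ vietoris_index u, vietoris_basic u K & vietoris_basic u `<=` V].
Proof.
move=> [D iD <-] [u Du uK]; exists u; split => //; first exact: iD.
by move=> L uL; exists u.
Qed.

Lemma open_hyperspace_of W : open W -> open (hyperspace_of W).
Proof.
move=> oW.
have -> : hyperspace_of W = vietoris_basic (0, fun=> W).
  apply/seteqP; split=> K /=.
    move=> KW; split=> [x /KW Wx|i _]; first by exists 0.
    by have [x Kx] := hyperspace_nonempty K; exists x; split => //; exact: KW.
  by move=> [KW _] x /KW[].
by apply: open_vietoris_basic => i _.
Qed.

Lemma open_hyperspace_meet W : open W ->
  open [set K : hyperspace Y | K `&` W !=set0].
Proof.
move=> oW; pose U i := if i is 0 then [set: Y] else W.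
have -> : [set K : hyperspace Y | K `&` W !=set0] = vietoris_basic (1, U).
  apply/seteqP; split=> K /=.
    move=> KW; split=> [x _|[|i] _ //]; first by exists 0.
    by rewrite setIT; exact: hyperspace_nonempty.
  by move=> [_ /(_ 1 isT)].
by apply: open_vietoris_basic => -[|i] _ //; exact: openT.
Qed.

(** Finitely many of the sets [O] cover [C], and filters are closed under finite intersections;
    near-covering compactness packages this. *)
Lemma filter_hyperspace_disjoint (F : set_system (hyperspace Y)) (C : set Y) :
  Filter F -> compact C ->
  (forall z, C z -> exists2 O, open_nbhs z O &
    F [set K : hyperspace Y | ~ (K `&` O !=set0)]) ->
  F [set K : hyperspace Y | ~ (K `&` C !=set0)].
Proof.
move=> FF /compact_near_coveringP cC FC.
have : F [set K : hyperspace Y | C `<=` (fun z => ~ (K : set Y) z)].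
  apply: (cC _ F (fun K z => ~ hyperspace_set K z) FF) => z /FC[O zO FO].
  exists (O, [set K : hyperspace Y | ~ (K `&` O !=set0)]).
    by split => //; exact: open_nbhs_nbhs.
  by move=> [x K] [/= Ox KO] Kx; apply: KO; exists x.
by apply: filterS => K CK [x [Kx Cx]]; exact: CK Kx.
Qed.

(** An ultrafilter [F] converges to the set [L] of points each of whose neighbourhoods meets
    [F]-almost every [K]: almost every [K] misses a given closed set disjoint from [L]. *)
Lemma hyperspace_compactT : compact [set: Y] -> compact [set: hyperspace Y].
Proof.
move=> cY; rewrite compact_ultra => F UF _.
pose missed O := F [set K : hyperspace Y | ~ (K `&` O !=set0)].
have missedP O : ~ missed O -> F [set K : hyperspace Y | K `&` O !=set0].
  by have [//|] := in_ultra_setVsetC [set K : hyperspace Y | K `&` O !=set0] UF.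
pose L := [set z | forall O, open_nbhs z O -> ~ missed O].
have FC C : closed C -> C `<=` ~` L -> missed C.
  move=> cC CL; apply: filter_hyperspace_disjoint => [|z /CL].
    exact: closed_compact.
  by move=> /existsNP[O] /not_implyP[zO /contrapT FO]; exists O.
have cL : closed L.
  move=> z Lz O [oO Oz]; have [x [Lx Ox]] := Lz O (open_nbhs_nbhs (conj oO Oz)).
  exact: Lx.
(* If [L] were empty, almost every [K] would miss the whole space and so be empty. *)
have L_neq0 : L !=set0.
  apply: contrapT => L0.
  have : missed setT.
    by apply: FC => [|z _ Lz]; [exact: closedT|apply: L0; exists z].
  move=> /(@filter_ex _ F _)[K]; apply; rewrite setIT; exact: hyperspace_nonempty.
exists (Hyperspace (closed_compact cY cL) L_neq0); split => // V.
rewrite nbhsE => -[W [oW LW] WV]; apply: filterS WV _.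
have [[n U] [oU [/= LU LUi] UW]] := open_vietorisP oW LW.
suff : F (vietoris_basic (n, U)) by exact: filterS.
rewrite /vietoris_basic /=; apply: filterI.
  have : missed (~` \bigcup_(i in [set i | i <= n]) U i).
    apply: FC => [|z nUz /LU//].
    by apply/open_closedC/bigcup_open => i; exact: (oU i).
  rewrite /missed; apply: filterS => K KU x Kx; apply: contrapT => nUx; apply: KU.
  by exists x.
suff : F [set K : hyperspace Y | forall i : 'I_n.+1, K `&` U i !=set0].
  by apply: filterS => K KU i ni; exact: (KU (Ordinal (ni : i < n.+1))).
apply: filter_forall => i; apply: missedP.
have in_ : i <= n by exact: (ltn_ord i).
have [z [Lz Uz]] := LUi i in_.
by apply: Lz; split => //; exact: (oU i in_).
Qed.

(** For [z] in [K] but not in [L], take an open [W] around [L] whose closure avoids [z]: no set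
    inside [W] meets the complement of that closure, whereas [K] does. *)
Lemma hyperspace_hausdorff : compact [set: Y] -> hausdorff_space Y ->
  hausdorff_space (hyperspace Y).
Proof.
move=> cY hY.
have sep K L z : (K : set Y) z -> ~ (L : set Y) z -> ~ cluster (nbhs K) L.
  move=> Kz nLz; have cL := hyperspace_closed (K := L) hY.
  have [|W [oW LW Wz]] := compact_shrink cY hY cL (open_setC1 z hY).
    by move=> x Lx xz; apply: nLz; rewrite -xz.
  have oO : open (~` closure W) by exact/closed_openC/closed_closure.
  move=> /(_ [set M : hyperspace Y | M `&` ~` closure W !=set0] (hyperspace_of W)).
  case=> [||M [[x [Mx nWx]] MW]]; [| |by apply/nWx/subset_closure/MW].
  - apply: open_nbhs_nbhs; split; first exact: open_hyperspace_meet.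
    by exists z; split => // /Wz; apply.
  - by apply: open_nbhs_nbhs; split; first exact: open_hyperspace_of.
move=> K L KL; apply: hyperspace_inj; apply/seteqP; split=> z Kz.
  by apply: contrapT => nLz; exact: sep Kz nLz KL.
apply: contrapT => nKz; apply: sep Kz nKz _ => A B LA KB.
by rewrite setIC; exact: KL.
Qed.

End Hyperspace.

(** * Transfer of the Menger property to the hyperspace, and the equivalences *)

Lemma menger_hyperspaceP (Z : topologicalType) (X : set Z) :
  compact [set: Z] -> hausdorff_space Z ->
  menger_in (~` X) <-> menger_in (~` hyperspace_of X).
Proof.
move=> cZ hZ; have cK := hyperspace_compactT cZ.
split=> mY U oU YU.
(* Selecting one member of [W n] costs only finitely many members of [U n]. *)
- pose W n := [set O | open O /\ exists V, [/\ V `<=` U n, finite_set V &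
    forall K : hyperspace Z, K `&` O !=set0 -> (\bigcup_(P in V) P) K]].
  have [n O []//|n y nXy|S [SW YS]] := mY W.
    pose Ky := [set K : hyperspace Z | (K : set Z) y].
    have cKy : compact Ky.
      apply: closed_compact => //; rewrite -openC.
      have -> : ~` Ky = hyperspace_of (~` [set y]).
        apply/seteqP; split=> K /=.
          by move=> nKy x Kx xy; apply: nKy; rewrite /Ky /= -xy.
        by move=> Ky' /Ky'; exact.
      exact/open_hyperspace_of/open_setC1.
    have [|V [VU fV KyV]] := compact_finite_subcover cKy (oU n).
      by move=> K Ky'; apply: YU => KX; apply: nXy; exact: KX.
    have oV : open (\bigcup_(P in V) P) by apply: bigcup_open => P /VU; exact: oU.
    (* A tube argument over the compact hyperspace: the finite family [V] covering the compact sets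
       through [y] also covers those through any point near [y]. *)
    have : nbhs y [set x | [set: hyperspace Z] `<=`
        (fun K => hyperspace_set K x -> (\bigcup_(P in V) P) K)].
      have /compact_near_coveringP near_cK := cK.
      apply: (near_cK _ (nbhs y)
        (fun x (K : hyperspace Z) => (K : set Z) x -> (\bigcup_(P in V) P) K)) => K _.
      have [Ky'|nKy] := pselect ((K : set Z) y).
        exists (\bigcup_(P in V) P, setT); last by move=> [L x] [].
        by split; [apply: open_nbhs_nbhs; split => //; exact: KyV|exact: filterT].
      have [|O [oO KO Oy]] :=
          compact_shrink cZ hZ (hyperspace_closed (K := K) hZ) (open_setC1 y hZ).
        by move=> x Kx xy; apply: nKy; rewrite -xy.
      exists (hyperspace_of O, ~` closure O); last first.
        by move=> [L x] [/= LO nOx] Lx; case: nOx; apply/subset_closure/LO.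
      split; apply: open_nbhs_nbhs; split => //.
      + exact: open_hyperspace_of.
      + exact/closed_openC/closed_closure.
      + by move=> /Oy; apply.
    rewrite nbhsE => -[O [oO Oy] OV]; exists O => //; split => //.
    by exists V; split => // K [x [Kx Ox]]; exact: (OV x Ox K I Kx).
  have /choice[V VP] : forall n, exists V, [/\ V `<=` U n, finite_set V &
      forall O (K : hyperspace Z), S n O -> K `&` O !=set0 ->
        (\bigcup_(P in V) P) K].
    move=> n; have [SWn fS] := SW n.
    have /choice[g gP] : forall O, exists V, S n O -> [/\ V `<=` U n, finite_set V &
        forall K : hyperspace Z, K `&` O !=set0 -> (\bigcup_(P in V) P) K].
      move=> O; have [SO|nSO] := pselect (S n O); last by exists set0.
      by have [_ [V VP]] := SWn O SO; exists V.
    exists (\bigcup_(O in S n) g O); split.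
    + by move=> P [O SO gP']; have [+ _ _] := gP O SO; exact.
    + by apply: bigcup_finite => // O SO; have [] := gP O SO.
    + move=> O K SO KO; have [_ _ /(_ K KO)[P gOP PK]] := gP O SO.
      by exists P => //; exists O.
  exists V; split=> [n|K nKX]; first by have [] := VP n.
  have [y [Ky nXy]] := nonsubset nKX.
  have [n _ [O SO Oy]] := YS y nXy; exists n => //.
  by have [_ _ VK] := VP n; apply: VK SO _; exists y.
(* Each open [O] is replaced by the compact sets meeting it; evaluating at singletons recovers a
   cover of points. *)
- pose meet O := [set K : hyperspace Z | K `&` O !=set0].
  have [n _ [O UO <-]|n K nKX|V [VU YV]] := mY (fun n => meet @` U n).
  + by apply: open_hyperspace_meet; exact: oU UO.
  + have [y [Ky nXy]] := nonsubset nKX.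
    have [O UO Oy] := YU n y nXy.
    by exists (meet O); [exists O|exists y].
  have /choice[g gP] : forall nP : nat * set (hyperspace Z), exists O,
      V nP.1 nP.2 -> U nP.1 O /\ meet O = nP.2.
    move=> [n P]; have [VP|nVP] := pselect (V n P); last by exists set0.
    by have [O UO OP] := (VU n).1 P VP; exists O.
  exists (fun n => (fun P => g (n, P)) @` V n); split=> [n|y nXy].
    split; last by apply: finite_image; exact: (VU n).2.
    by move=> _ [P VP <-]; have [] := gP (n, P) VP.
  have [|n _ [P VP Py]] := YV (hyperspace1 y).
    by move=> /(_ y erefl).
  exists n => //; exists (g (n, P)); first by exists P.
  have [_ /= gE] := gP (n, P) VP; move: Py; rewrite -{1}gE.
  by move=> [x [<- Ox]].
Qed.

Theorem theorem3p4 (Z : topologicalType) (X : set Z)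
    (Zcompact : compact [set: Z]) (Zhausdorff : hausdorff_space Z) :
  [<-> I_wins_kporada X;
       I_wins_porada (hyperspace_of X);
       I_wins_kporada (hyperspace_of X);
       ~ menger (set_type (~` X));
       ~ menger (set_type (~` (hyperspace_of X)))].
Proof.
have cK := hyperspace_compactT Zcompact.
have hK := hyperspace_hausdorff Zcompact Zhausdorff.
have mK := menger_hyperspaceP X Zcompact Zhausdorff.
have cl (K : hyperspace Z) := hyperspace_closed (K := K) Zhausdorff.
tfae.
- move=> /(kporada_not_menger Zcompact Zhausdorff).
  apply: not_menger_I_wins => // [K U oU UK|L U UL UX].
    (* Only the union of the [W i] has to be shrunk around [K]: any [L] containing [K] meets each
       [W i] automatically. *)
    have [[n W] [oW [/= KW KWi] WU]] := open_vietorisP oU UK.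
    have [|V [oV KV VW]] := compact_shrink Zcompact Zhausdorff (cl K) _ KW.
      by apply: bigcup_open => i; exact: (oW i).
    exists V; split => // L KL LV; apply: WU; split; first exact: subset_trans VW.
    move=> i ni; have [x [Kx Wx]] := KWi i ni.
    by exists x; split => //; exact: KL.
  by apply: UX => n _; exact: UL.
- exact: I_wins_porada_kporada.
- move=> /(kporada_not_menger cK hK) + /menger_set_typeP; apply: contra_not.
  by move/mK.
- by move=> + /menger_set_typeP/mK/menger_set_typeP.
- move=> nm; have {}nm : ~ menger_in (~` X) by move=> /mK/menger_set_typeP.
  apply: not_menger_I_wins nm => // [K U oU KU|L U UL UX].
    have [V [oV KV VU]] := compact_shrink Zcompact Zhausdorff (cl K) oU KU.
    by exists V; split => // L _ LV; exact: subset_trans VU.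
  by apply: subset_trans UX => x Lx n _; exact: UL.
Qed.
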